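(* Let $r>0$ be real. For all positive definite complex matrices $X,Y$ of the same size, $$\operatorname{Tr}(X:Y)^r+\bigl(2-2^{-r}\bigr)\,\lVert X^{1/2}Y^{1/2}\rVert_r^r\le \operatorname{Tr}X^r+\operatorname{Tr}Y^r .$$ Moreover, the coefficient $2-2^{-r}$ is optimal: there is no real constant $c>2-2^{-r}$ such that $$\operatorname{Tr}(X:Y)^r+c\,\lVert X^{1/2}Y^{1/2}\rVert_r^r\le \operatorname{Tr}X^r+\operatorname{Tr}Y^r$$ holds for all positive definite complex matrices $X,Y$ of the same size.
   Context: All matrices are finite-dimensional complex matrices and $\operatorname{Tr}$ is the usual non-normalized trace; $\operatorname{Tr}Z^r$ means $\operatorname{Tr}(Z^r)$. For positive definite $X,Y$ the parallel sum is $X:Y=(X^{-1}+Y^{-1})^{-1}$. For $p>0$ and a matrix $Z$, $\lVert Z\rVert_p=(\operatorname{Tr}|Z|^p)^{1/p}$ with $|Z|=(Z^*Z)^{1/2}$ (a Schatten quasi-norm when $0<p<1$). Real powers of positive definite matrices are defined by functional calculus. *)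

(* Defs.v *)
From mathcomp Require Import all_boot all_order all_algebra.
From mathcomp Require Import complex.
From mathcomp Require Import reals exp.

Set Implicit Arguments.
Unset Strict Implicit.
Unset Printing Implicit Defensive.

Import Order.TTheory GRing.Theory Num.Theory.
Local Open Scope ring_scope.
Local Open Scope complex_scope.
Local Open Scope sesquilinear_scope.

Section Matrices.
Variable R : realType.
Implicit Types (n : nat) (p : R).

(* The order on R[i] is partial: 0 < z says that z is real and positive. *)
Definition posdefmx n (A : 'M[R[i]]_n) : Prop :=
  A \is hermsymmx /\
  forall u : 'cV[R[i]]_n, u != 0 -> 0 < (u^t* *m A *m u) 0 0.

(* f(A) = P^-1 diag(f(a_1), ..., f(a_n)) P for the unitary diagonalization
   A = P^-1 diag(a_1, ..., a_n) P given by spectralmx and spectral_diag. It is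
   meaningful for Hermitian A: the a_i are then real, and f(A) does not depend
   on the diagonalization. *)
Definition hermfun n (f : R -> R) (A : 'M[R[i]]_n) : 'M[R[i]]_n :=
  invmx (spectralmx A)
    *m diag_mx (map_mx (fun a => (f (complex.Re a))%:C) (spectral_diag A))
    *m spectralmx A.

Definition mxpowR n (A : 'M[R[i]]_n) p : 'M[R[i]]_n :=
  hermfun (fun a => a `^ p) A.

Definition mxabs n (Z : 'M[R[i]]_n) : 'M[R[i]]_n := mxpowR (Z^t* *m Z) 2^-1.

(* The trace of |Z|^p is real, so that taking its real part loses nothing. *)
Definition schatten n p (Z : 'M[R[i]]_n) : R :=
  (complex.Re (\tr (mxpowR (mxabs Z) p))) `^ p^-1.

Definition parsum n (X Y : 'M[R[i]]_n) : 'M[R[i]]_n :=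
  invmx (invmx X + invmx Y).

End Matrices.

(* Main.v *)
Require Import Defs.
From mathcomp Require Import all_boot all_order all_algebra.
From mathcomp Require Import complex.
From mathcomp Require Import reals sequences exp.
From mathcomp Require Import perm ring lra.
Import Order.TTheory GRing.Theory Num.Theory.
Local Open Scope ring_scope.
Local Open Scope complex_scope.

(** Put A = X^(1/2) and B = Y^(1/2), so that |AB|^2 = M with M = B X B. Let the
    eigenvalues of X : Y, M, X, Y be h_j, m_j, x_j, y_j, all in decreasing
    order, and let S be the sum of the m_j^(r/2), that is ||AB||_r^r. The
    inequality is the sum of two independent ones,

      Tr (X : Y)^r <= 2^-r S      and      2 S <= Tr X^r + Tr Y^r.

    The first holds eigenvalue by eigenvalue: h_j <= sqrt(m_j) / 2
    (parsum_eig_le). On the span of the top j + 1 eigenvectors of X : Y the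
    form of X^-1 + Y^-1 is at most 1 / h_j; together with
    X + 4 h_j^2 X^-1 >= 4 h_j this gives X >= 4 h_j^2 Y^-1 there as quadratic
    forms, which is M >= 4 h_j^2 on the image of that span under B^-1, and the
    Courant-Fischer principle (courant_fischer) concludes.

    The second is a Hoelder inequality, valid for every r > 0 through
    log-majorization. Cauchy interlacing gives
    det(W X W^* ) <= x_0 ... x_(k-1) det(W W^* ) for every W with k <= n rows
    (det_compression_le). With W = E B, where the rows of E are the top k
    eigenvectors of M, and then with E and Y in place of W and X, this becomes
    Horn's inequality m_0 ... m_(k-1) <= x_0 y_0 ... x_(k-1) y_(k-1)
    (prod_eig_le). Hence S is at most the sum of the (x_j y_j)^(r/2)
    (weak_log_majorization), and the arithmetic-geometric mean inequality
    bounds twice this sum by Tr X^r + Tr Y^r.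

    Both inequalities are equalities when X = Y = 1, whence the optimality of
    the constant. *)

Set Implicit Arguments.
Unset Strict Implicit.
Unset Printing Implicit Defensive.

Local Open Scope sesquilinear_scope.

Section TraceInequality.
Variable R : realType.
Local Notation C := R[i].
Implicit Types (d e f : nat -> R).

(** * Conjugate transposes and unitary diagonalizations *)

Lemma trmxC_mul m n p (A : 'M[C]_(m, n)) (B : 'M[C]_(n, p)) :
  (A *m B)^t* = B^t* *m A^t*.
Proof. by rewrite trmx_mul map_mxM. Qed.

Lemma trmxC1 n : (1%:M : 'M[C]_n)^t* = 1%:M.
Proof. by rewrite trmx1 map_mx1. Qed.

Lemma trmxC_inv n (A : 'M[C]_n) : (invmx A)^t* = invmx (A^t*).
Proof. by rewrite trmx_inv map_invmx. Qed.

Lemma hermsymmxP n (A : 'M[C]_n) : reflect (A^t* = A) (A \is hermsymmx).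
Proof.
by rewrite is_hermitianmxE expr0 scale1r eq_sym; apply/eqP.
Qed.

Lemma unitarymx_mulVmx n (U : 'M[C]_n) : U \is unitarymx -> U^t* *m U = 1%:M.
Proof.
by move=> hU; rewrite -invmx_unitary// mulVmx// unitarymx_unit.
Qed.

(** The diagonal matrix with real entries d 0, ..., d (n - 1); the other values
    of d are irrelevant. *)
Definition diagR n d : 'M[C]_n := diag_mx (\row_(i < n) (d i)%:C).

(** A = U^* diag(d) U with U unitary: the rows of U are adjoints of
    eigenvectors. Eigenvalues are indexed by nat, so that sums over the first k
    of them need no cast between ordinals. *)
Definition eigdec n (A : 'M[C]_n) (U : 'M[C]_n) d : Prop :=
  U \is unitarymx /\ A = U^t* *m diagR n d *m U.

Definition antitone_upto n d : Prop :=
  forall i j, (i <= j)%N -> (j < n)%N -> d j <= d i.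

Definition pos_upto n d : Prop := forall i, (i < n)%N -> 0 < d i.

Lemma diagR_herm n d : (diagR n d)^t* = diagR n d.
Proof.
rewrite /diagR tr_diag_mx map_diag_mx; congr diag_mx.
by apply/rowP => i; rewrite !mxE; apply: conj_Creal; rewrite complex_real.
Qed.

Lemma mul_diagR n d e : diagR n d *m diagR n e = diagR n (fun i => d i * e i).
Proof.
rewrite /diagR mulmx_diag; congr diag_mx.
by apply/rowP => i; rewrite !mxE rmorphM.
Qed.

Lemma diagR1 n d : (forall i, (i < n)%N -> d i = 1) -> diagR n d = 1%:M.
Proof.
by move=> d1; apply/matrixP => i j; rewrite !mxE d1.
Qed.

Lemma eigdec_herm n (A U : 'M[C]_n) d : eigdec A U d -> A \is hermsymmx.
Proof.
case=> _ ->; apply/hermsymmxP.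
by rewrite !trmxC_mul trmxCK diagR_herm mulmxA.
Qed.

Lemma eigdec_mul n (A B U : 'M[C]_n) d e : eigdec A U d -> eigdec B U e ->
  eigdec (A *m B) U (fun i => d i * e i).
Proof.
case=> hU -> [_ ->]; split=> //.
by rewrite !mulmxA (mulmxtVK _ hU) -(mulmxA _ (diagR n d)) mul_diagR.
Qed.

Lemma eigdec_inv n (A U : 'M[C]_n) d : pos_upto n d -> eigdec A U d ->
  A \in unitmx /\ eigdec (invmx A) U (fun i => (d i)^-1).
Proof.
move=> d0 hA; have [hU _] := hA.
have hV : eigdec (U^t* *m diagR n (fun i => (d i)^-1) *m U) U
    (fun i => (d i)^-1).
  by split.
have [_ E] := eigdec_mul hA hV.
move: E; rewrite (@diagR1 n (fun i => d i * (d i)^-1)); last first.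
  by move=> i ni; rewrite divff// gt_eqF// d0.
rewrite mulmx1 unitarymx_mulVmx// => E.
have [uA _] := mulmx1_unit E; split=> //.
rewrite (_ : invmx A = U^t* *m diagR n (fun i => (d i)^-1) *m U) //.
by rewrite -[RHS](mulKmx uA) E mulmx1.
Qed.

(** The functional calculus may be computed in any unitary diagonalization. If
    D and s are two diagonal forms of A and Q is the change of basis, then
    D Q = Q s, so that Q can be nonzero at (i, j) only if d_i = s_j, and
    f(D) Q = Q f(s) follows entrywise. *)
Lemma eigdec_hermfun n (A U : 'M[C]_n) d (f : R -> R) : eigdec A U d ->
  eigdec (hermfun f A) U (fun i => f (d i)).
Proof.
move=> hA; have [hU EA] := hA; split=> //.
have /hermitian_normalmx/orthomx_spectralP := eigdec_herm hA.
rewrite /hermfun; set P := spectralmx A; set s := spectral_diag A => EA2.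
have uP : P \in unitmx by exact: spectral_unit.
pose Q := U *m invmx P.
have DQ : diagR n d *m Q = Q *m diag_mx s.
  rewrite /Q.
  have : U *m A *m invmx P = U *m A *m invmx P by [].
  by rewrite {1}EA EA2 !mulmxA (mulmxK uP) (unitarymxP hU) mul1mx.
have fDQ : diagR n (fun i => f (d i)) *m Q =
    Q *m diag_mx (map_mx (fun a => (f (complex.Re a))%:C) s).
  apply/matrixP => i j; move: DQ; move: (Q) => Q0 /matrixP/(_ i j).
  rewrite !mul_diag_mx !mul_mx_diag !mxE => /eqP.
  rewrite mulrC -subr_eq0 -mulrBr mulf_eq0 => /orP[/eqP->|].
    by rewrite mul0r mulr0.
  by rewrite subr_eq0 => /eqP <- /=; rewrite mulrC.
have -> : invmx P = U^t* *m Q by rewrite /Q mulmxA unitarymx_mulVmx// mul1mx.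
by rewrite -(mulmxA _ Q) -fDQ /Q !mulmxA mulmxKV.
Qed.

Lemma eigdec_trace n (A U : 'M[C]_n) d : eigdec A U d ->
  \tr A = (\sum_(i < n) d i)%:C.
Proof.
case=> hU ->; rewrite mxtrace_mulC mulmxA (unitarymxP hU) mul1mx.
by rewrite mxtrace_diag rmorph_sum; apply: eq_bigr => i _; rewrite mxE.
Qed.

Lemma eigdec_det n (A U : 'M[C]_n) d : eigdec A U d ->
  \det A = (\prod_(i < n) d i)%:C.
Proof.
case=> hU ->; rewrite !det_mulmx mulrAC -det_mulmx unitarymx_mulVmx//.
rewrite det1 mul1r det_diag rmorph_prod; apply: eq_bigr => i _.
by rewrite mxE.
Qed.

(** The spectral theorem, with the eigenvalues sorted by a permutation. *)
Lemma hermsymmx_eigdec n (A : 'M[C]_n) : A \is hermsymmx ->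
  exists U d, eigdec A U d /\ antitone_upto n d.
Proof.
move=> hA; have /hermitian_normalmx/orthomx_spectralP := hA.
rewrite invmx_unitary ?spectral_unitarymx//.
have := hermitian_spectral_diag_real hA.
have := spectral_unitarymx A.
set P := spectralmx A; set D := spectral_diag A => hP realD EA.
pose t := [tuple complex.Re (D 0 i) | i < n].
have pst : perm_eq (sort >=%R t) t by rewrite perm_sort.
have /tuple_permP[p Ep] := pst.
have sz : size (sort >=%R t) = n by rewrite size_sort size_tuple.
exists (row_perm p P), (nth 0 (sort >=%R t)); split; last first.
  move=> i j ij jn.
  have tr : transitive (>=%R : rel R).
    by move=> a b c /= h1 h2; apply: le_trans h2 h1.
  have st : sorted >=%R (sort >=%R t).
    by apply: sort_sorted => a b /=; exact: le_total.
  have rf : reflexive (>=%R : rel R) by move=> a; exact: lexx.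
  have iin := leq_ltn_trans ij jn.
  by apply: (sorted_leq_nth tr rf 0 st) ij; rewrite inE sz.
have nthE (i : 'I_n) : nth 0 (sort >=%R t) i = complex.Re (D 0 (p i)).
  by rewrite Ep (nth_map i) ?size_enum_ord// nth_ord_enum tnth_mktuple.
have hU : row_perm p P \is unitarymx.
  rewrite row_permE; apply: mul_unitarymx hP; apply/unitarymxP.
  rewrite tr_perm_mx map_perm_mx -perm_mxM mulgV; exact: perm_mx1.
split=> //; rewrite EA; apply/matrixP => a b.
rewrite !mul_mx_diag !mxE (reindex_inj (@perm_inj _ p)) /=.
apply: eq_bigr => i _; rewrite !mxE; congr (_ * _ * _).
by rewrite nthE RRe_real//; move/mxOverP: realD; apply.
Qed.

(** * Quadratic forms and positive definiteness *)

(** The quadratic form of A on row vectors. Its values are complex numbers; for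
    Hermitian A they are real, hence comparable in the partial order of C. *)
Definition qform n (A : 'M[C]_n) (v : 'rV[C]_n) : C := (v *m A *m v^t*) 0 0.

Lemma eigdec_qform n (A U : 'M[C]_n) d v : eigdec A U d ->
  qform A v = \sum_(i < n) (d i)%:C * `|(v *m U^t*) 0 i| ^+ 2.
Proof.
case=> hU ->; rewrite /qform.
have -> : v *m (U^t* *m diagR n d *m U) *m v^t* =
    (v *m U^t*) *m diagR n d *m (v *m U^t*)^t*.
  by rewrite trmxC_mul trmxCK !mulmxA.
rewrite mxE; apply: eq_bigr => i _; rewrite mul_mx_diag !mxE normCK.
by rewrite mulrAC mulrC.
Qed.

Lemma qform1E n (v : 'rV[C]_n) : qform 1%:M v = \sum_(i < n) `|v 0 i| ^+ 2.
Proof.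
by rewrite /qform mulmx1 mxE; apply: eq_bigr => i _; rewrite !mxE normCK.
Qed.

Lemma qform1_ge0 n (v : 'rV[C]_n) : 0 <= qform 1%:M v.
Proof. by rewrite qform1E sumr_ge0// => i _; rewrite exprn_ge0. Qed.

Lemma qform1_gt0 n (v : 'rV[C]_n) : v != 0 -> 0 < qform 1%:M v.
Proof.
move=> v0; rewrite lt_def qform1_ge0 andbT; apply: contra v0.
rewrite qform1E psumr_eq0 => [/allP h|i _]; last by rewrite exprn_ge0.
apply/eqP/rowP => i; rewrite mxE; have /(_ i) := h.
by rewrite mem_index_enum expf_eq0 normr_eq0 /= => /(_ isT)/eqP.
Qed.

Lemma qform_mul k n (A : 'M[C]_n) (W : 'M[C]_(k, n)) v :
  qform A (v *m W) = qform (W *m A *m W^t*) v.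
Proof. by rewrite /qform trmxC_mul !mulmxA. Qed.

Lemma qformD n (A B : 'M[C]_n) v : qform (A + B) v = qform A v + qform B v.
Proof. by rewrite /qform mulmxDr mulmxDl mxE. Qed.

Lemma posdefmxP n (A : 'M[C]_n) : posdefmx A <->
  A \is hermsymmx /\ forall v, v != 0 -> 0 < qform A v.
Proof.
split=> [[hA pA]|[hA pA]]; split=> // u u0.
- have := pA (u^t*); rewrite trmxCK; apply.
  by apply: contra u0 => /eqP h; rewrite -(trmxCK u) h trmx0 map_mx0.
- have := pA (u^t*); rewrite /qform trmxCK; apply.
  by apply: contra u0 => /eqP h; rewrite -(trmxCK u) h trmx0 map_mx0.
Qed.

Lemma posdefmx_eig_gt0 n (A U : 'M[C]_n) d : posdefmx A -> eigdec A U d ->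
  pos_upto n d.
Proof.
move=> /posdefmxP[_ pA] hA i ni; pose j := Ordinal ni.
have [hU _] := hA.
have E : row j U *m U^t* = delta_mx 0 j.
  by rewrite rowE -mulmxA (unitarymxP hU) mulmx1.
have /pA : row j U != 0.
  apply/eqP => h; move: E; rewrite h mul0mx => /rowP/(_ j).
  rewrite !mxE !eqxx /=.
  by move/eqP; rewrite eq_sym oner_eq0.
rewrite (eigdec_qform _ hA) E (bigD1 j)//= big1 => [|k kj].
  by rewrite addr0 mxE !eqxx normr1 expr1n mulr1 ltcR.
by rewrite mxE (negbTE kj) normr0 expr0n mulr0.
Qed.

Lemma eigdec_posdef n (A U : 'M[C]_n) d : pos_upto n d -> eigdec A U d ->
  posdefmx A.
Proof.
move=> d0 hA; have [hU _] := hA; apply/posdefmxP.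
split; first exact: eigdec_herm hA.
move=> v v0.
have v'0 : v *m U^t* != 0.
  apply: contra v0 => /eqP h.
  by rewrite -(mulmx1 v) -(unitarymx_mulVmx hU) mulmxA h mul0mx.
have pos i : 0 <= (d (nat_of_ord i))%:C * `|(v *m U^t*) 0 i| ^+ 2 :> C.
  by rewrite mulr_ge0 ?exprn_ge0// lecR ltW// d0.
rewrite (eigdec_qform _ hA) lt_def sumr_ge0 ?andbT => [|i _ //].
apply: contra v'0; rewrite psumr_eq0 => [/allP h|i _ //].
apply/eqP/rowP => i; rewrite [RHS]mxE; have /(_ i) := h.
rewrite mem_index_enum => /(_ isT) /=; rewrite mulf_eq0 expf_eq0 normr_eq0 /=.
move=> /orP[/eqP/complexI E|/eqP//].
by have := d0 _ (ltn_ord i); rewrite E ltxx.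
Qed.

Lemma posdefmx_eigdec n (A : 'M[C]_n) : posdefmx A ->
  exists U d, [/\ eigdec A U d, antitone_upto n d & pos_upto n d].
Proof.
move=> pA; have [/hermsymmx_eigdec[U [d [hA sd]]] _] := pA.
by exists U, d; split=> //; apply: posdefmx_eig_gt0 hA.
Qed.

Lemma posdefmx_unit n (A : 'M[C]_n) : posdefmx A -> A \in unitmx.
Proof.
by move=> /posdefmx_eigdec[U [d [hA _ d0]]]; have [] := eigdec_inv d0 hA.
Qed.

Lemma posdefmx_inv n (A : 'M[C]_n) : posdefmx A -> posdefmx (invmx A).
Proof.
move=> /posdefmx_eigdec[U [d [hA _ d0]]]; have [_] := eigdec_inv d0 hA.
by apply: eigdec_posdef => i ni; rewrite invr_gt0 d0.
Qed.

Lemma posdefmxD n (A B : 'M[C]_n) :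
  posdefmx A -> posdefmx B -> posdefmx (A + B).
Proof.
move=> /posdefmxP[/hermsymmxP hA pA] /posdefmxP[/hermsymmxP hB pB].
apply/posdefmxP; split.
  by apply/hermsymmxP; rewrite linearD map_mxD hA hB.
by move=> v v0; rewrite qformD addr_gt0 ?pA ?pB.
Qed.

Lemma posdefmx_conj k n (A : 'M[C]_n) (W : 'M[C]_(k, n)) : row_free W ->
  posdefmx A -> posdefmx (W *m A *m W^t*).
Proof.
move=> fW /posdefmxP[/hermsymmxP hA pA]; apply/posdefmxP; split.
  by apply/hermsymmxP; rewrite !trmxC_mul trmxCK hA !mulmxA.
move=> v v0; rewrite -qform_mul pA//; apply: contra v0 => /eqP h.
by apply/eqP; apply: (row_free_inj fW); rewrite h mul0mx.
Qed.

(** * Eigenvalues of compressions *)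

(** If the form of A is at least t on a subspace of dimension j + 1, here the
    row space of W, then the j-th largest eigenvalue (counted from 0) is at
    least t: by dimension, the subspace contains a nonzero vector orthogonal to
    the first j eigenvectors. *)
Lemma courant_fischer n (A U : 'M[C]_n) d j (W : 'M[C]_(j.+1, n)) t :
  eigdec A U d -> antitone_upto n d -> (j < n)%N -> row_free W ->
  (forall x, t%:C * qform 1%:M (x *m W) <= qform A (x *m W)) -> t <= d j.
Proof.
move=> hA sd jn fW hW; have [hU _] := hA.
pose F := colsub (widen_ord (ltnW jn)) (U^t*).
have [x x0 xF] : exists2 x : 'rV_j.+1, x != 0 & x *m (W *m F) = 0.
  have : kermx (W *m F) != 0.
    rewrite kermx_eq0 /row_free neq_ltn (leq_ltn_trans (rank_leq_col _))//.
  case/rowV0Pn => x /sub_kermxP xF x0; by exists x.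
pose v := x *m W.
have v0 : v != 0.
  by apply: contra x0 => /eqP h; apply/eqP/(row_free_inj fW); rewrite mul0mx.
have yz (i : 'I_n) : (i < j)%N -> (v *m U^t*) 0 i = 0.
  move=> ij; move/rowP/(_ (Ordinal ij)): xF; rewrite mulmxA -/v.
  rewrite [RHS]mxE => <-; rewrite !mxE; apply: eq_bigr => k _; rewrite !mxE.
  by congr (_ * (U _ _)^*); apply: val_inj.
have vU : qform 1%:M v = \sum_(i < n) `|(v *m U^t*) 0 i| ^+ 2.
  by rewrite -qform1E qform_mul mulmx1 trmxCK unitarymx_mulVmx.
have up : qform A v <= (d j)%:C * qform 1%:M v.
  rewrite (eigdec_qform _ hA) vU mulr_sumr; apply: ler_sum => i _.
  have [ij|ij] := ltnP i j; first by rewrite yz// normr0 expr0n !mulr0.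
  by rewrite ler_wpM2r ?exprn_ge0// lecR sd.
by have := le_trans (hW x) up; rewrite ler_pM2r ?qform1_gt0// lecR.
Qed.

(** The first k rows of U, which are eigenvectors for the k largest eigenvalues
    when U diagonalizes a matrix with decreasing eigenvalues. *)
Definition toprows n k (kn : (k <= n)%N) (U : 'M[C]_n) : 'M[C]_(k, n) :=
  rowsub (widen_ord kn) U.

Lemma toprows_mulC n k (kn : (k <= n)%N) (U : 'M[C]_n) : U \is unitarymx ->
  toprows kn U *m U^t* = toprows kn 1%:M.
Proof. by move=> hU; rewrite /toprows mul_rowsub_mx (unitarymxP hU). Qed.

Lemma toprows_diag n k (kn : (k <= n)%N) (d : nat -> R) :
  toprows kn 1%:M *m diagR n d *m (toprows kn 1%:M)^t* = diagR k d.
Proof.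
apply/matrixP => i j; rewrite /toprows mul_rowsub_mx mul1mx.
rewrite mxE (bigD1 (widen_ord kn j))//= big1 ?addr0 => [|l lj].
  by rewrite !mxE eqxx conjC1 mulr1 -!val_eqE.
by rewrite !mxE (eq_sym (widen_ord kn j)) (negbTE lj) conjC0 mulr0.
Qed.

Lemma toprows_eigdec n k (kn : (k <= n)%N) (A U : 'M[C]_n) d :
  eigdec A U d -> toprows kn U *m A *m (toprows kn U)^t* = diagR k d.
Proof.
case=> hU ->; rewrite !mulmxA toprows_mulC//.
rewrite -(mulmxA _ U) -{1}(trmxCK U) -trmxC_mul.
by rewrite toprows_mulC// toprows_diag.
Qed.

Lemma toprows_unitary n k (kn : (k <= n)%N) (U : 'M[C]_n) :
  U \is unitarymx -> toprows kn U \is unitarymx.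
Proof.
move=> hU; apply/unitarymxP.
have h : eigdec 1%:M U (fun=> 1).
  by split=> //; rewrite diagR1// mulmx1 unitarymx_mulVmx.
by have := toprows_eigdec kn h; rewrite mulmx1 diagR1.
Qed.

Lemma unitarymx_free k n (W : 'M[C]_(k, n)) : W \is unitarymx -> row_free W.
Proof. by move=> hW; rewrite /row_free mxrank_unitary. Qed.

Lemma qform_diagR n d (v : 'rV[C]_n) :
  qform (diagR n d) v = \sum_(i < n) (d i)%:C * `|v 0 i| ^+ 2.
Proof.
have h : eigdec (diagR n d) 1%:M d.
  split; rewrite ?trmxC1 ?mulmx1 ?mul1mx//.
  by apply/unitarymxP; rewrite trmxC1 mulmx1.
by rewrite (eigdec_qform _ h) trmxC1 mulmx1.
Qed.

(** Cauchy interlacing, upper half: the eigenvalues of a compression W A W^* to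
    a subspace with orthonormal basis W are dominated by those of A. *)
Lemma cauchy_interlace k n (A U : 'M[C]_n) d (W : 'M[C]_(k, n)) V e j :
  W \is unitarymx -> eigdec A U d -> antitone_upto n d ->
  eigdec (W *m A *m W^t*) V e -> antitone_upto k e -> (j < k)%N -> e j <= d j.
Proof.
move=> hW hA sd hB se jk.
have kn : (k <= n)%N by rewrite -(mxrank_unitary hW) rank_leq_col.
have [hV _] := hB; have hE := toprows_unitary jk hV.
apply: (courant_fischer (W := toprows jk V *m W) hA sd) => [||x].
- exact: leq_trans jk kn.
- by apply/unitarymx_free/mul_unitarymx.
rewrite mulmxA [in leRHS]qform_mul [in leRHS]qform_mul (toprows_eigdec jk hB).
rewrite [in leLHS]qform_mul mulmx1 (unitarymxP hW) [in leLHS]qform_mul mulmx1.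
rewrite (unitarymxP hE) qform1E qform_diagR mulr_sumr.
apply: ler_sum => i _; rewrite ler_wpM2r ?exprn_ge0// lecR se//.
by rewrite -ltnS.
Qed.

(** Gram-Schmidt reduces to orthonormal rows, where it is interlacing. *)
Lemma det_compression_le k n (A U : 'M[C]_n) d (W : 'M[C]_(k, n)) :
  (k <= n)%N -> posdefmx A -> eigdec A U d -> antitone_upto n d ->
  \det (W *m A *m W^t*) <= (\prod_(i < k) d i)%:C * \det (W *m W^t*).
Proof.
move=> kn pA hA sd.
have hS := schmidt_unitarymx W kn.
have /submxP[L ->] := schmidt_sub W; set S := schmidt W in hS *.
have pB : posdefmx (S *m A *m S^t*).
  by apply: posdefmx_conj => //; exact: unitarymx_free.
have [V [e [hB se e0]]] := posdefmx_eigdec pB.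
have -> : L *m S *m A *m (L *m S)^t* = L *m (S *m A *m S^t*) *m L^t*.
  by rewrite trmxC_mul !mulmxA.
have -> : L *m S *m (L *m S)^t* = L *m L^t*.
  by rewrite trmxC_mul !mulmxA mulmxtVK.
rewrite !det_mulmx (eigdec_det hB) mulrAC mulrC.
have L0 : 0 <= \det L * \det (L^t*).
  by rewrite det_map_mx det_tr mul_conjC_ge0.
rewrite ler_wpM2r// lecR; apply: ler_prod => i _.
rewrite ltW ?e0//=; exact: (cauchy_interlace hS hA sd hB se).
Qed.

(** * Weak log-majorization *)

(** Abel summation: by induction, each partial sum of the c_i x_i is at least
    its last coefficient times the partial sum of the x_i. *)
Lemma abel_sum_ge0 n (c x : nat -> R) :
  antitone_upto n c -> (forall i, (i < n)%N -> 0 <= c i) ->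
  (forall k, (k <= n)%N -> 0 <= \sum_(i < k) x i) ->
  0 <= \sum_(i < n) c i * x i.
Proof.
case: n => [|n] sc c0 x0; first by rewrite big_ord0.
suff H k : (k <= n)%N -> c k * \sum_(i < k.+1) x i <= \sum_(i < k.+1) c i * x i.
  by apply: le_trans (H n (leqnn n)); rewrite mulr_ge0 ?c0 ?x0.
elim: k => [_|k IH kn]; first by rewrite !big_ord1.
rewrite big_ord_recr [leRHS]big_ord_recr /= mulrDr lerD2r.
by apply: le_trans (IH (ltnW kn)); rewrite ler_wpM2r ?sc ?x0// ltnW.
Qed.

(** Since e^z >= 1 + z, p^q - m^q >= q m^q (ln p - ln m); the coefficients
    q m^q decrease and the partial sums of ln p - ln m are nonnegative. *)
Lemma weak_log_majorization n (m p : nat -> R) (q : R) : 0 < q ->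
  pos_upto n m -> pos_upto n p -> antitone_upto n m ->
  (forall k, (k <= n)%N -> \prod_(i < k) m i <= \prod_(i < k) p i) ->
  \sum_(i < n) m i `^ q <= \sum_(i < n) p i `^ q.
Proof.
move=> q0 m0 p0 sm mp; rewrite -subr_ge0 -sumrB.
have ln_prod k (g : nat -> R) : (forall i, (i < k)%N -> 0 < g i) ->
    ln (\prod_(i < k) g i) = \sum_(i < k) ln (g i) /\ 0 < \prod_(i < k) g i.
  elim: k => [|k IH] g0; first by rewrite !big_ord0 ln1.
  have [|E P] := IH; first by move=> i ik; apply: g0; apply: leqW.
  rewrite !big_ord_recr/= lnM ?posrE ?g0// E; split=> //.
  by rewrite mulr_gt0// g0.
apply: le_trans (_ : \sum_(i < n) (m i `^ q * q) * (ln (p i) - ln (m i)) <= _).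
  apply: (@abel_sum_ge0 n (fun i => m i `^ q * q)
    (fun i => ln (p i) - ln (m i))).
  - move=> i j ij jn; rewrite ler_wpM2r ?(ltW q0)// ge0_ler_powR ?(ltW q0)//.
    + by rewrite nnegrE ltW// m0.
    + by rewrite nnegrE ltW// m0// (leq_ltn_trans ij).
    + exact: sm.
  - by move=> i _; rewrite mulr_ge0 ?powR_ge0// ltW.
  - move=> k kn; rewrite sumrB subr_ge0.
    have [<- P1] := ln_prod k m (fun i ik => m0 i (leq_trans ik kn)).
    have [<- P2] := ln_prod k p (fun i ik => p0 i (leq_trans ik kn)).
    by rewrite ler_ln ?posrE// mp.
apply: ler_sum => i _.
have mi := m0 i (ltn_ord i); have pi := p0 i (ltn_ord i).
have -> : p i `^ q = m i `^ q * expR (q * (ln (p i) - ln (m i))).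
  rewrite /powR !gt_eqF// -expRD; congr expR; ring.
have := expR_ge1Dx (q * (ln (p i) - ln (m i))).
move/(ler_wpM2l (powR_ge0 (m i) q)); lra.
Qed.

(** * Singular values of X^(1/2) Y^(1/2) *)

Lemma mxpowR_posdef n (A : 'M[C]_n) p : posdefmx A -> posdefmx (mxpowR A p).
Proof.
move=> /posdefmx_eigdec[U [d [hA _ d0]]].
by apply: eigdec_posdef (eigdec_hermfun _ hA) => i ni; rewrite powR_gt0// d0.
Qed.

Lemma mxpowR_half_sqr n (A : 'M[C]_n) : posdefmx A ->
  mxpowR A 2^-1 *m mxpowR A 2^-1 = A.
Proof.
move=> /posdefmx_eigdec[U [d [hA _ d0]]].
have h := eigdec_hermfun (fun a => a `^ 2^-1) hA.
have [_ ->] := eigdec_mul h h; have [_ ->] := hA.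
congr (_ *m diag_mx _ *m _); apply/rowP => i; rewrite !mxE.
by rewrite powR12_sqrt -?expr2 ?sqr_sqrtr// ltW// d0.
Qed.

Lemma posdefmx_herm n (A : 'M[C]_n) : posdefmx A -> A^t* = A.
Proof. by case=> /hermsymmxP. Qed.

Lemma posdefmx_half_conj n (X Y : 'M[C]_n) : posdefmx X -> posdefmx Y ->
  posdefmx (mxpowR Y 2^-1 *m X *m mxpowR Y 2^-1).
Proof.
move=> pX pY; have pB := mxpowR_posdef 2^-1 pY.
rewrite -{2}(posdefmx_herm pB); apply: posdefmx_conj pX.
by rewrite row_free_unit posdefmx_unit.
Qed.

(** With A = X^(1/2) and B = Y^(1/2), |AB|^2 = B X B; so the r-th power of the
    Schatten quasi-norm is the sum of the (r/2)-th powers of the eigenvalues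
    of B X B. *)
Lemma schatten_eig n (X Y V : 'M[C]_n) m r :
  0 < r -> posdefmx X -> posdefmx Y ->
  eigdec (mxpowR Y 2^-1 *m X *m mxpowR Y 2^-1) V m ->
  schatten r (mxpowR X 2^-1 *m mxpowR Y 2^-1) `^ r
    = \sum_(i < n) m i `^ (r / 2).
Proof.
move=> r0 pX pY; set A := mxpowR X 2^-1; set B := mxpowR Y 2^-1 => hM.
have E : (A *m B)^t* *m (A *m B) = B *m X *m B.
  have hA : A^t* = A := posdefmx_herm (mxpowR_posdef 2^-1 pX).
  have hB : B^t* = B := posdefmx_herm (mxpowR_posdef 2^-1 pY).
  have AA : A *m A = X := mxpowR_half_sqr pX.
  clearbody A B; rewrite trmxC_mul hA hB.
  by rewrite -AA !mulmxA.
rewrite /schatten /mxabs E.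
have hZ := eigdec_hermfun (fun a => a `^ 2^-1) hM.
rewrite (eigdec_trace (eigdec_hermfun (fun a => a `^ r) hZ)) /=.
rewrite -powRrM mulVf ?gt_eqF// powRr1; last first.
  by rewrite sumr_ge0// => i _; rewrite powR_ge0.
by apply: eq_bigr => i _; rewrite -powRrM mulrC.
Qed.

(** Horn's inequality for the singular values of X^(1/2) Y^(1/2): with E the
    top k eigenrows of B X B, where B = Y^(1/2), and W = E B, the product of
    the m_i is det (W X W^* ), and W W^* = E Y E^*. *)
Lemma prod_eig_le n (X Y U V W : 'M[C]_n) x y m k :
  posdefmx X -> posdefmx Y -> (k <= n)%N ->
  eigdec X U x -> antitone_upto n x -> eigdec Y V y -> antitone_upto n y ->
  eigdec (mxpowR Y 2^-1 *m X *m mxpowR Y 2^-1) W m ->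
  \prod_(i < k) m i <= \prod_(i < k) (x i * y i).
Proof.
move=> pX pY kn hX sx hY sy; set B := mxpowR Y 2^-1 => hM.
have BB : B *m B = Y := mxpowR_half_sqr pY.
have [hW _] := hM; have hB : B^t* = B := posdefmx_herm (mxpowR_posdef 2^-1 pY).
clearbody B.
have prodE (f : nat -> R) : (\prod_(i < k) f i)%:C = \det (diagR k f).
  by rewrite det_diag rmorph_prod; apply: eq_bigr => i _; rewrite mxE.
rewrite -lecR prodE -(toprows_eigdec kn hM); set E := toprows kn W.
have -> : E *m (B *m X *m B) *m E^t* = (E *m B) *m X *m (E *m B)^t*.
  by rewrite trmxC_mul hB !mulmxA.
apply: le_trans (det_compression_le (E *m B) kn pX hX sx) _.
have -> : (E *m B) *m (E *m B)^t* = E *m Y *m E^t*.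
  by rewrite trmxC_mul hB -BB !mulmxA.
rewrite big_split rmorphM/=; apply: ler_wpM2l.
  rewrite lecR prodr_ge0// => i _.
  by rewrite ltW// (posdefmx_eig_gt0 pX hX)// (leq_trans _ kn).
apply: le_trans (det_compression_le E kn pY hY sy) _.
by rewrite (unitarymxP (toprows_unitary kn hW)) det1 mulr1.
Qed.

(** The j-th eigenvalue of the parallel sum is at most half the j-th singular
    value of X^(1/2) Y^(1/2). The proof applies courant_fischer to the image
    under Y^(-1/2) of the span of the top j + 1 eigenrows v of X : Y: there
    h_j v (X^-1 + Y^-1) v^* <= v v^*, and X >= 4 h_j - 4 h_j^2 X^-1 always, so
    v X v^* >= 4 h_j^2 v Y^-1 v^*. *)
Lemma parsum_eig_le n (X Y U V : 'M[C]_n) h m j :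
  posdefmx X -> posdefmx Y -> (j < n)%N ->
  eigdec (parsum X Y) U h -> antitone_upto n h ->
  eigdec (mxpowR Y 2^-1 *m X *m mxpowR Y 2^-1) V m -> antitone_upto n m ->
  4 * h j ^+ 2 <= m j.
Proof.
move=> pX pY jn hH sh; set B := mxpowR Y 2^-1 => hM sm.
have pB : posdefmx B := mxpowR_posdef 2^-1 pY.
have BB : B *m B = Y := mxpowR_half_sqr pY; clearbody B.
have hB := posdefmx_herm pB; have uB := posdefmx_unit pB.
have [hU _] := hH.
have pP : posdefmx (invmx X + invmx Y) by apply: posdefmxD; exact: posdefmx_inv.
have h0 : pos_upto n h by apply: posdefmx_eig_gt0 hH; exact: posdefmx_inv.
have [_] := eigdec_inv h0 hH; rewrite /parsum invmxK => hP.
have hE := toprows_unitary jn hU.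
apply: (courant_fischer (W := toprows jn U *m invmx B) hM sm jn) => [|x].
  by rewrite /row_free mxrankMfree ?row_free_unit ?unitmx_inv// mxrank_unitary.
rewrite mulmxA; set v := x *m toprows jn U.
have -> : qform 1%:M (v *m invmx B) = qform (invmx Y) v.
  rewrite qform_mul mulmx1 trmxC_inv hB; congr (qform _ _).
  have uY := posdefmx_unit pY.
  have : invmx B *m invmx B *m Y = 1%:M.
    by rewrite -BB mulmxA mulmxKV// mulVmx.
  by move=> h1; rewrite -[LHS](mulmxK uY) h1 mul1mx.
have -> : qform (B *m X *m B) (v *m invmx B) = qform X v.
  by rewrite qform_mul trmxC_inv hB !mulmxA mulVmx// mul1mx mulmxK.
(* The eigenvalues of X^-1 + Y^-1 on the top eigenrows are h_i^-1 <= h_j^-1. *)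
have up : (h j)%:C * (qform (invmx X) v + qform (invmx Y) v) <= qform 1%:M v.
  rewrite -qformD /v [in leLHS]qform_mul (toprows_eigdec jn hP).
  rewrite [in leRHS]qform_mul mulmx1 (unitarymxP hE) qform1E qform_diagR.
  rewrite mulr_sumr; apply: ler_sum => i _; rewrite mulrA -rmorphM.
  rewrite ler_piMl ?exprn_ge0// lecR.
  have ij : (i <= j)%N by rewrite -ltnS.
  by rewrite ler_pdivrMr ?mul1r ?sh// h0// (leq_ltn_trans ij).
(* 0 <= (1 - s X^-1) X (1 - s X^-1) = X - 2 s + s^2 X^-1 with s = 2 h_j. *)
have dn : (4 * h j)%:C * qform 1%:M v <=
    qform X v + (4 * h j ^+ 2)%:C * qform (invmx X) v.
  have uX := posdefmx_unit pX; have hX := posdefmx_herm pX.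
  pose s := (2 * h j)%:C : C.
  have sr : s^*%R = s by apply: conj_Creal; rewrite complex_real.
  have ge0 : 0 <= qform X (v - s *: (v *m invmx X)).
    have /posdefmxP[_ qX] := pX.
    have [->|/qX/ltW//] := eqVneq (v - s *: (v *m invmx X)) 0.
    by rewrite /qform !mul0mx mxE.
  have iXh : (invmx X)^t* = invmx X by rewrite trmxC_inv hX.
  have T : (v - s *: (v *m invmx X))^t* = v^t* - s *: (invmx X *m v^t*).
    rewrite -[in RHS]iXh -trmxC_mul.
    apply/matrixP => i k; rewrite !mxE rmorphB rmorphM.
    by congr (_ - _ * _); exact: sr.
  have E : (v - s *: (v *m invmx X)) *m X *m (v - s *: (v *m invmx X))^t*
      = v *m X *m v^t* + (s * s) *: (v *m invmx X *m v^t*)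
        - (s + s) *: (v *m 1%:M *m v^t*).
    rewrite T mulmx1 mulmxBl -scalemxAl mulmxKV//.
    rewrite mulmxBr !mulmxBl -!scalemxAl -!scalemxAr.
    rewrite !mulmxA mulmxK// scalerA.
    by rewrite scalerDl opprB opprD !addrA; congr (_ - _); rewrite addrAC.
  rewrite -subr_ge0; suff <- : qform X (v - s *: (v *m invmx X)) =
      qform X v + (4 * h j ^+ 2)%:C * qform (invmx X) v
        - (4 * h j)%:C * qform 1%:M v by [].
  rewrite /qform E.
  rewrite mxE [in LHS]mxE [in X in _ + X = _]mxE [in X in (_ + X) - _ = _]mxE.
  rewrite [in X in _ - X = _]mxE.
  rewrite -rmorphM -rmorphD; congr (_ + _%:C * _ - _%:C * _); ring.
have h2 : 0 <= (4 * h j)%:C :> C by rewrite lecR mulr_ge0// ltW// h0.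
have := ler_wpM2l h2 up.
rewrite mulrA -rmorphM -mulrA -expr2 => up2.
by have := le_trans up2 dn; rewrite mulrDr addrC lerD2r.
Qed.

(** * The two halves of the inequality *)

Lemma half_powR (r : R) : 2^-1 `^ r = 2 `^ (- r).
Proof. by rewrite -powR_inv1// -powRrM mulN1r. Qed.

Lemma tr_mxpowR n (A U : 'M[C]_n) d p : eigdec A U d ->
  \tr (mxpowR A p) = (\sum_(i < n) d i `^ p)%:C.
Proof.
by move=> hA; rewrite (eigdec_trace (eigdec_hermfun (fun a => a `^ p) hA)).
Qed.

Lemma parsum_trace_le n (X Y : 'M[C]_n) r : 0 < r ->
  posdefmx X -> posdefmx Y ->
  \tr (mxpowR (parsum X Y) r) <=
    (2 `^ (- r) * schatten r (mxpowR X 2^-1 *m mxpowR Y 2^-1) `^ r)%:C.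
Proof.
move=> r0 pX pY.
have pH : posdefmx (parsum X Y).
  by apply: posdefmx_inv; apply: posdefmxD; exact: posdefmx_inv.
have pM := posdefmx_half_conj pX pY.
have [U [h [hH sh h0]]] := posdefmx_eigdec pH.
have [V [m [hM sm m0]]] := posdefmx_eigdec pM.
rewrite (tr_mxpowR _ hH) (schatten_eig r0 pX pY hM) lecR mulr_sumr.
apply: ler_sum => i _.
have mi := m0 i (ltn_ord i); have hi := h0 i (ltn_ord i).
have hm2 := parsum_eig_le pX pY (ltn_ord i) hH sh hM sm.
have hm : h i <= 2^-1 * m i `^ 2^-1.
  rewrite -(ler_pXn2r (n := 2))// ?nnegrE ?mulr_ge0 ?invr_ge0 ?powR_ge0//;
    last exact: ltW.
  rewrite powR12_sqrt ?(ltW mi)// exprMn sqr_sqrtr ?(ltW mi)//.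
  lra.
apply: le_trans (_ : (2^-1 * m i `^ 2^-1) `^ r <= _).
  apply: ge0_ler_powR hm; rewrite ?nnegrE ?(ltW r0) ?(ltW hi)//.
  by rewrite mulr_ge0 ?invr_ge0 ?powR_ge0.
by rewrite powRM ?invr_ge0 ?powR_ge0// half_powR -powRrM [2^-1 * r]mulrC.
Qed.

Lemma schatten_le n (X Y : 'M[C]_n) r : 0 < r ->
  posdefmx X -> posdefmx Y ->
    (2 * schatten r (mxpowR X 2^-1 *m mxpowR Y 2^-1) `^ r)%:C
    <= \tr (mxpowR X r) + \tr (mxpowR Y r).
Proof.
move=> r0 pX pY.
have pM := posdefmx_half_conj pX pY.
have [U [x [hX sx x0]]] := posdefmx_eigdec pX.
have [V [y [hY sy y0]]] := posdefmx_eigdec pY.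
have [W [m [hM sm m0]]] := posdefmx_eigdec pM.
rewrite (tr_mxpowR _ hX) (tr_mxpowR _ hY) (schatten_eig r0 pX pY hM).
rewrite -rmorphD lecR -big_split mulrC -ler_pdivlMr//=.
(* Log-majorization, then the arithmetic-geometric mean inequality. *)
apply: le_trans (_ : \sum_(i < n) (x i * y i) `^ (r / 2) <= _).
  apply: (@weak_log_majorization n m (fun i => x i * y i)) => //.
  - by rewrite divr_gt0.
  - by move=> i ni; rewrite mulr_gt0 ?x0 ?y0.
  - by move=> k kn; exact: (prod_eig_le pX pY kn hX sx hY sy hM).
rewrite mulr_suml; apply: ler_sum => i _.
have xi := ltW (x0 i (ltn_ord i)); have yi := ltW (y0 i (ltn_ord i)).
rewrite powRM// [r / 2]mulrC [_ * r]mulrC !powRrM !powR12_sqrt ?powR_ge0//.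
have := sqr_ge0 (Num.sqrt (x i `^ r) - Num.sqrt (y i `^ r)).
rewrite sqrrB !sqr_sqrtr ?powR_ge0//; lra.
Qed.

End TraceInequality.

Theorem theorem3p3 (R : realType) (r : R) (hr : 0 < r) :
  (forall (n : nat) (X Y : 'M[R[i]]_n), posdefmx X -> posdefmx Y ->
     \tr (mxpowR (parsum X Y) r)
       + ((2 - 2 `^ (- r))
            * schatten r (mxpowR X 2^-1 *m mxpowR Y 2^-1) `^ r)%:C
     <= \tr (mxpowR X r) + \tr (mxpowR Y r)) /\
  ~ (exists c : R, 2 - 2 `^ (- r) < c /\
      forall (n : nat) (X Y : 'M[R[i]]_n), posdefmx X -> posdefmx Y ->
        \tr (mxpowR (parsum X Y) r)
          + (c * schatten r (mxpowR X 2^-1 *m mxpowR Y 2^-1) `^ r)%:C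
        <= \tr (mxpowR X r) + \tr (mxpowR Y r)).
Proof.
split=> [n X Y pX pY|[c [hc H]]].
  apply: le_trans (schatten_le hr pX pY).
  rewrite mulrBl rmorphB addrCA gerDl subr_le0.
  exact: parsum_trace_le.
(* For X = Y = 1 of size 1 the inequality reads 2^-r + c <= 2. *)
have h1 : eigdec (1%:M : 'M[R[i]]_1) 1%:M (fun=> 1).
  have u1 : (1%:M : 'M[R[i]]_1) \is unitarymx.
    by apply/unitarymxP; rewrite trmxC1 mulmx1.
  by split=> //; rewrite trmxC1 diagR1// !mulmx1.
have p1 : posdefmx (1%:M : 'M[R[i]]_1) by apply: eigdec_posdef h1 => i _.
have h2 : eigdec (parsum 1%:M 1%:M : 'M[R[i]]_1) 1%:M (fun=> 2^-1).
  have h2 : eigdec (1%:M + 1%:M : 'M[R[i]]_1) 1%:M (fun=> 2).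
    have [u1 _] := h1; split=> //; rewrite trmxC1 mulmx1 mul1mx.
    by apply/matrixP => i j; rewrite !mxE !ord1 eqxx !mulr1n -rmorphD.
  by rewrite /parsum invmx1; have [|] := eigdec_inv _ h2.
have hB := eigdec_hermfun (fun a => a `^ 2^-1) h1.
have hM := eigdec_mul (eigdec_mul hB h1) hB.
have := H 1 1%:M 1%:M p1 p1.
rewrite (tr_mxpowR _ h2) (tr_mxpowR _ h1) (schatten_eig hr p1 p1 hM).
rewrite -!rmorphD lecR !big_ord1 !powR1 !mulr1 powR1 half_powR; lra.
Qed.
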